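(* Let $G=(V,E)$ be a connected graph with $n=|V|\ge 3$, weights $w$ and costs $c$, and let $B>0$. Suppose there exists $F\subseteq E$ with $c(F)\le B$ and profit $p_G(F)=\Delta$. Then the procedure below outputs a set of cost at most $B$ whose profit is at least $$\frac{\Delta}{4}\left(\frac{1}{\log n}-\frac{1}{\log^2 n}\right)=\Omega\!\left(\frac{\Delta}{\log n}\right).$$ Procedure ($\mathcal{W}=\{w(e):e\in E\}$). Phase 1: for every $\{u,v\}\in E$ and $W\in\mathcal{W}$, let $C$ be a minimum-cost set of edges of $(V,\{f\in E:w(f)<W\})$ separating $u$ from $v$ in that graph; let $C_0$ be such a $C$ with $c(C)\le B$ maximizing $p_G(C)$ ($C_0=\emptyset$ if none has positive profit). Phase 2: set $G'=(V,E')=G$, $F_g=\emptyset$, $b=0$; repeat: for every $\{u,v\}\in E'$ and $W\in\mathcal{W}$ let $C$ be a minimum-cost set of edges of $(V,\{f\in E':w(f)<W\})$ separating $u$ from $v$ in that graph and $p=W-w(\{u,v\})$; among those with $b<b+c(C)\le B$ pick $C^*$ maximizing $p/c(C)$ with maximum value $r^*$ ($r^*=0$, $C^*=\emptyset$ if no candidate has positive ratio); set $G'\leftarrow G'\setminus C^*$, $b\leftarrow b+c(C^* )$, $F_g\leftarrow F_g\cup C^*$; continue while $r^*>0$. Output $C_0$ if $p_G(C_0)\ge p_G(F_g)$, otherwise output $F_g$.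
   Context: $w:E\to\mathbb{R}_{\ge0}$, $c:E\to\mathbb{R}_{>0}$, $c(D)=\sum_{f\in D}c(f)$, $G\setminus D=(V,E\setminus D)$. $\mathrm{MST}(\cdot)$ is minimum spanning tree weight w.r.t. $w$ ($\infty$ for disconnected graphs); $p_G(D)=\mathrm{MST}(G\setminus D)-\mathrm{MST}(G)$ is the profit of $D$. $\log=\log_2$.
   Formalization: The profit Δ of F is taken to be finite (F does not disconnect G), since for Δ = ∞ the claim fails, e.g. on a triangle with equal weights; the bound is proved for every possible run of the procedure, and the Ω(Δ/log n) form is not stated separately. *)

(* Defs.v *)
From HB Require Import structures.
From mathcomp Require Import all_boot all_order all_algebra.
From mathcomp Require Import reals constructive_ereal exp.
Set Implicit Arguments. Unset Strict Implicit. Unset Printing Implicit Defensive.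
Import Order.TTheory GRing.Theory Num.Theory.
Local Open Scope ring_scope.

Section Graphs.
Variable V : finType.
Variable R : realType.

Definition edges_ok (E : {set {set V}}) : Prop := forall e, e \in E -> #|e| = 2%N.

Definition adj (E : {set {set V}}) : rel V := fun x y => [set x; y] \in E.

Definition gconnected (E : {set {set V}}) : bool :=
  [forall x : V, [forall y : V, connect (adj E) x y]].

(* T is a spanning tree of (V, E'): a minimally connected spanning subgraph
   (i.e. connected and acyclic) *)
Definition spanning_tree (E' T : {set {set V}}) : bool :=
  [&& T \subset E', gconnected T & [forall e in T, ~~ gconnected (T :\ e)]].

Definition wsum (w : {set V} -> R) (D : {set {set V}}) : R := \sum_(f in D) w f.

(* MST(V,E') w.r.t. w; +oo when (V,E') has no spanning tree (disconnected) *)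
Definition MST (w : {set V} -> R) (E' : {set {set V}}) : \bar R :=
  \big[mine/+oo%E]_(T : {set {set V}} | spanning_tree E' T) (wsum w T)%:E.

Definition profit (w : {set V} -> R) (E D : {set {set V}}) : \bar R :=
  (MST w (E :\: D) - MST w E)%E.

Definition weights (w : {set V} -> R) (E : {set {set V}}) : pred R :=
  fun W => [exists e in E, w e == W].

Definition lighter (w : {set V} -> R) (E' : {set {set V}}) (W : R) : {set {set V}} :=
  [set f in E' | w f < W].

Definition separates (H C : {set {set V}}) (u v : V) : Prop :=
  C \subset H /\ ~~ connect (adj (H :\: C)) u v.

Definition min_sep (c : {set V} -> R) (H C : {set {set V}}) (u v : V) : Prop :=
  separates H C u v /\
  forall C', separates H C' u v -> wsum c C <= wsum c C'.

Definition valid_cuts (w c : {set V} -> R) (E E' : {set {set V}})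
  (cut : V -> V -> R -> {set {set V}}) : Prop :=
  forall u v W, [set u; v] \in E' -> weights w E W ->
    min_sep c (lighter w E' W) (cut u v W) u v.

Definition phase1 (w c : {set V} -> R) (E : {set {set V}}) (B : R)
  (C0 : {set {set V}}) : Prop :=
  exists cut, valid_cuts w c E E cut /\
  let cand u v W := [/\ [set u; v] \in E, weights w E W & wsum c (cut u v W) <= B] in
  ((exists u v W, [/\ cand u v W, C0 = cut u v W, (0 < profit w E C0)%E &
       forall u' v' W', cand u' v' W' -> (profit w E (cut u' v' W') <= profit w E C0)%E])
   \/
   (C0 = set0 /\ forall u v W, cand u v W -> (profit w E (cut u v W) <= 0)%E)).

(* Phase 2: [phase2 w c E B E' b Fg Fout] means that running the loop of
   phase 2 from the state (G' = (V,E'), b, F_g) may terminate with F_g = Fout.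
   In each iteration, the candidates are the (u,v,W) with {u,v} in E', W in
   the weight set, and b < b + c(C) <= B, with ratio (W - w{u,v}) / c(C). *)
Inductive phase2 (w c : {set V} -> R) (E : {set {set V}}) (B : R) :
  {set {set V}} -> R -> {set {set V}} -> {set {set V}} -> Prop :=
| phase2_stop E' b Fg cut :
    valid_cuts w c E E' cut ->
    (forall u v W, [set u; v] \in E' -> weights w E W ->
       b < b + wsum c (cut u v W) <= B ->
       (W - w [set u; v]) / wsum c (cut u v W) <= 0) ->
    phase2 w c E B E' b Fg Fg
| phase2_step E' b Fg cut u v W Fout :
    valid_cuts w c E E' cut ->
    [set u; v] \in E' -> weights w E W ->
    b < b + wsum c (cut u v W) <= B ->
    0 < (W - w [set u; v]) / wsum c (cut u v W) ->
    (forall u' v' W', [set u'; v'] \in E' -> weights w E W' ->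
       b < b + wsum c (cut u' v' W') <= B ->
       (W' - w [set u'; v']) / wsum c (cut u' v' W')
         <= (W - w [set u; v]) / wsum c (cut u v W)) ->
    phase2 w c E B (E' :\: cut u v W) (b + wsum c (cut u v W))
                   (Fg :|: cut u v W) Fout ->
    phase2 w c E B E' b Fg Fout.

Definition output (w : {set V} -> R) (E C0 Fg : {set {set V}}) : {set {set V}} :=
  if (profit w E Fg <= profit w E C0)%E then C0 else Fg.

End Graphs.

Definition log2 {R : realType} (x : R) : R := ln x / ln 2.

(* Main.v *)
Require Import Defs.
From HB Require Import structures.
From mathcomp Require Import all_boot all_order all_algebra.
From mathcomp Require Import ring lra.
From mathcomp Require Import reals constructive_ereal exp.
Import Order.TTheory GRing.Theory Num.Theory.
Local Open Scope ring_scope.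

(** Let [T] be a minimum spanning tree of [G \ F] and [T0] one of the current
    graph [H]. Running Kruskal's algorithm on [T], each edge [e] of [T] merges two
    components; let [A e] be the smaller one. Basis exchange matches [e]
    injectively with an edge [g e] of [T0] leaving [A e]. The edges of [F] leaving
    [A e] separate the ends of [g e] below the weight [w e], and this cut raises
    the minimum spanning tree weight by at least [w e - w (g e)]; these gains add
    up to [Delta] minus the profit already obtained. A vertex lies in the smaller
    component at most [log2 n] times, so the cuts cost at most [2 log2 n * c F]
    in total, and some cut has a good gain/cost ratio in every state of the greedy
    loop. If the loop stops because such a cut no longer fits, then the greedy
    profit plus the gain of that cut is large, and phase 1 has considered a cut
    with at least the same gain. *)

(** * Connectivity in edge sets and edge exchange across a cut *)

Section Connectivity.
Set Implicit Arguments.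
Unset Strict Implicit.
Variable V : finType.
Implicit Types (S T L X : {set {set V}}) (A : {set V}) (x y u v : V).

Definition crosses A : pred {set V} :=
  fun f => [exists a in f, a \in A] && [exists b in f, b \notin A].

Lemma conn_sym S : connect_sym (adj S).
Proof. by apply: sym_connect_sym => x y; rewrite /adj setUC. Qed.

Lemma sub_conn S X : S \subset X -> subrel (connect (adj S)) (connect (adj X)).
Proof. by move=> /subsetP sSX; apply: connect_sub => x y /sSX; apply: connect1. Qed.

Lemma conn_setU1 S x y u v : connect (adj ([set x; y] |: S)) u v ->
  [\/ connect (adj S) u v, connect (adj S) u x /\ connect (adj S) y v
    | connect (adj S) u y /\ connect (adj S) x v].
Proof.
move=> /connectP[p + ->] {v}; elim: p u => [u _|z p IH u /=]; first exact: Or31.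
rewrite {1}/adj !inE => /andP[/orP[/eqP uz|uzS] /IH {IH}].
  have: (u \in [set x; y]) && (z \in [set x; y]) by rewrite -uz !inE !eqxx orbT.
  rewrite !inE => /andP[/orP[]/eqP-> /orP[]/eqP->] // [H|[H1 H2]|[H1 H2]];
    by [apply: Or31|apply: Or32|apply: Or33].
have Suz : connect (adj S) u z by apply: connect1.
by case=> [|[]|[]] /(connect_trans Suz);
  [apply: Or31|move=> *; apply: Or32|move=> *; apply: Or33].
Qed.

Lemma conn_bridge S x y : connect (adj S) x y ->
  subrel (connect (adj ([set x; y] |: S))) (connect (adj S)).
Proof.
move=> xy u v /conn_setU1[//|[ux yv]|[uy xv]].
  exact: connect_trans ux (connect_trans xy yv).
by apply: connect_trans uy (connect_trans _ xv); rewrite conn_sym.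
Qed.

Lemma closed_crosses S A :
  (forall f, f \in S -> ~~ crosses A f) -> closed (adj S) A.
Proof.
move=> ncr x y xyS; apply/idP/idP => [xA|yA]; apply/negPn/negP => nA;
  apply: (negP (ncr _ xyS)); apply/andP; split; apply/existsP.
- by exists x; rewrite set21.
- by exists y; rewrite set22.
- by exists y; rewrite set22.
- by exists x; rewrite set21.
Qed.

Lemma crosses_closed S A f : edges_ok S -> closed (adj S) A -> f \in S ->
  ~~ crosses A f.
Proof.
move=> okS cl fS; have /eqP/cards2P[x [y [_ Ef]]] := okS _ fS.
apply/negP => /andP[/existsP[a /andP[af aA]] /existsP[b /andP[bf /negP[]]]].
have xy : (x \in A) = (y \in A) by apply: cl; rewrite /adj -Ef.
move: af bf aA; rewrite Ef !inE.
by move=> /orP[]/eqP-> /orP[]/eqP->; rewrite ?xy.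
Qed.

(** A path of [T] from [u] to [v] must leave [A], and no edge of [L] does. Swapping the crossing
    edge [f] for [{u,v}] loses no connection, because the rest of the path and [{u,v}] still join
    the ends of [f]. *)
Lemma cut_exchange L T A u v : edges_ok T -> L \subset T ->
  closed (adj L) A -> u \in A -> v \notin A -> connect (adj T) u v ->
  exists f, [/\ f \in T, f \notin L, crosses A f &
    subrel (connect (adj T)) (connect (adj ([set u; v] |: (T :\ f))))].
Proof.
move=> okT sLT clL uA vA Tuv.
(* An inclusion-minimal edge set joining [u] to [v] stands for a simple path: removing any of its
   edges separates [u] from [v]. *)
pose P := fun S => (S \subset T) && connect (adj S) u v.
have [|S /minsetP[/andP[sST Suv] minS] _] := @minset_exists _ P T.
  by rewrite /P subxx.
have [f fS crf] : exists2 f, f \in S & crosses A f.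
  apply/exists_inP; apply: contraNT vA; rewrite negb_exists_in => /forall_inP ncr.
  by rewrite -(closed_connect (closed_crosses ncr) Suv).
have fT : f \in T by apply: (subsetP sST).
exists f; split=> //.
  by apply: contraL crf => fL; apply: crosses_closed clL fL => e /(subsetP sLT)/okT.
have /eqP/cards2P[a [b [_ Ef]]] := okT _ fT.
have nSuv : ~~ connect (adj (S :\ f)) u v.
  apply/negP => Suv'; have := minS (S :\ f).
  rewrite /P (subset_trans (subsetDl _ _) sST) Suv' subsetDl => /(_ isT isT) E.
  by move: fS; rewrite -E !inE eqxx.
set X := [set u; v] |: _.
have sSX : S :\ f \subset X by apply: subset_trans (setSD _ sST) (subsetUr _ _).
have Xuv : connect (adj X) u v by apply: connect1; rewrite /adj /X setU11.
have Xab : connect (adj X) a b.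
  move: Suv; rewrite -(setD1K fS) {1}Ef => /conn_setU1[|[ua bv]|[ub av]].
  - by rewrite (negbTE nSuv).
  - have /= := sub_conn sSX; move=> H.
    apply: (@connect_trans _ _ u); first by rewrite conn_sym H.
    by apply: (connect_trans Xuv); rewrite conn_sym H.
  - have /= := sub_conn sSX; move=> H.
    apply: (@connect_trans _ _ v); first exact: H.
    by rewrite conn_sym; apply: connect_trans Xuv; rewrite conn_sym H.
move=> p q Tpq; apply: (conn_bridge Xab); apply: sub_conn Tpq.
by rewrite -Ef /X setUCA -{1}(setD1K fT) subsetUr.
Qed.

Lemma gconnectedP S : reflect (forall x y, connect (adj S) x y) (gconnected S).
Proof.
by apply: (iffP forallP) => H x; [apply/forallP|apply/forallP => y]; apply: H.
Qed.

End Connectivity.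

(** * Minimum spanning trees under edge exchange and cut removal *)

Section MinimumSpanningTrees.
Set Implicit Arguments.
Unset Strict Implicit.
Variables (V : finType) (R : realType) (w : {set V} -> R).
Implicit Types (S T H C D : {set {set V}}) (u v : V).

Definition nneg_on H := forall e, e \in H -> 0 <= w e.

Lemma nneg_onS H H' : H \subset H' -> nneg_on H' -> nneg_on H.
Proof. by move=> /subsetP sHH' w0 e /sHH'/w0. Qed.

Lemma edges_okS H H' : H \subset H' -> edges_ok H' -> edges_ok H.
Proof. by move=> /subsetP sHH' ok e /sHH'/ok. Qed.

Lemma wsum0 : wsum w set0 = 0.
Proof. by rewrite /wsum big_set0. Qed.

Lemma wsum_ge0 D : nneg_on D -> 0 <= wsum w D.
Proof. by move=> w0; apply: sumr_ge0 => e /w0. Qed.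

Lemma wsumS D D' : nneg_on D' -> D \subset D' -> wsum w D <= wsum w D'.
Proof.
move=> w0 /setIidPr sDD'; rewrite /wsum [leRHS](big_setID D) /= sDD' lerDl.
by apply: sumr_ge0 => e /setDP[/w0].
Qed.

Lemma wsumU D D' : [disjoint D & D'] ->
  wsum w (D :|: D') = wsum w D + wsum w D'.
Proof. by move=> dD; rewrite /wsum -bigU //=; apply: eq_bigl => e; rewrite !inE. Qed.

(** Only an inequality: [e] may already lie in [T :\ f], and then adding it costs nothing. *)
Lemma wsum_exchange T e f : nneg_on (e |: T) -> f \in T ->
  wsum w (e |: (T :\ f)) <= wsum w T - w f + w e.
Proof.
move=> w0 fT; have -> : wsum w T - w f = wsum w (T :\ f).
  by rewrite /wsum (big_setD1 f fT) /= addrAC subrr add0r.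
have [eT|eT] := boolP (e \in T :\ f); last first.
  by rewrite /wsum big_setU1 //= addrC.
by rewrite [e |: _](setUidPr _) ?sub1set // lerDl w0 // setU11.
Qed.

Lemma exists_spanning_tree H : gconnected H -> exists T, spanning_tree H T.
Proof.
move=> Hc; have [T /minsetP[Tc minT] sTH] := minset_exists Hc.
exists T; rewrite /spanning_tree sTH Tc; apply/forall_inP => e eT.
apply/negP => /minT/(_ (subsetDl _ _)) E; move: eT; rewrite -E !inE eqxx //.
Qed.

Lemma spanning_treeS S H T : S \subset H -> spanning_tree S T -> spanning_tree H T.
Proof. by move=> sSH /and3P[sTS Tc mT]; apply/and3P; rewrite (subset_trans sTS). Qed.

Lemma MST_cases H :
  MST w H = +oo%E \/ exists2 T, spanning_tree H T & MST w H = (wsum w T)%:E.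
Proof.
rewrite /MST; elim/big_ind: _ => [|x y xP yP|T HT]; [by left| |by right; exists T].
by rewrite minEle; case: ifP.
Qed.

Lemma MST_le H S : nneg_on H -> S \subset H -> gconnected S ->
  (MST w H <= (wsum w S)%:E)%E.
Proof.
move=> w0 sSH /exists_spanning_tree[T ST].
apply: (@le_trans _ _ (wsum w T)%:E).
  by apply: Order.TotalTheory.bigmin_le_cond; apply: spanning_treeS ST.
by rewrite lee_fin wsumS //; [apply: nneg_onS w0|case/and3P: ST].
Qed.

Lemma MST_attained H : nneg_on H -> gconnected H ->
  exists2 T, spanning_tree H T & MST w H = (wsum w T)%:E.
Proof.
by move=> w0 Hc; case: (MST_cases H) => // E; have := MST_le w0 (subxx H) Hc; rewrite E.
Qed.

Lemma MSTS S H : nneg_on H -> S \subset H -> (MST w H <= MST w S)%E.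
Proof.
move=> w0 sSH; case: (MST_cases S) => [->|[T /and3P[sTS Tc _] ->]]; first exact: leey.
by apply: MST_le => //; apply: subset_trans sSH.
Qed.

Lemma lighter_sub H W : lighter w H W \subset H.
Proof. by apply/subsetP=> e; rewrite inE => /andP[]. Qed.

Lemma lighter_conn_closed H W u : closed (adj (lighter w H W))
  [set x | connect (adj (lighter w H W)) u x].
Proof.
move=> x y xy; rewrite !inE; exact: (connect_closed (@conn_sym _ _)).
Qed.

(** The component of [u] in the part of [T] lighter than [W] misses [v], so the edge that
    [cut_exchange] removes weighs at least [W]. *)
Lemma MST_le_exchange H T W u v : edges_ok H -> nneg_on H ->
  T \subset H -> gconnected T -> [set u; v] \in H ->
  ~~ connect (adj (lighter w T W)) u v ->
  (MST w H <= (wsum w T - W + w [set u; v])%:E)%E.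
Proof.
move=> okH w0 sTH /gconnectedP Tc uvH nuv.
have [||f [fT fL _ sub]] := cut_exchange (edges_okS sTH okH) (lighter_sub T W)
  (@lighter_conn_closed T W u) _ _ (Tc u v); rewrite ?inE ?connect0 //.
have leW : W <= w f by move: fL; rewrite inE fT /= -leNgt.
have sUH : [set u; v] |: T \subset H by rewrite subUset sub1set uvH.
apply: (@le_trans _ _ (wsum w ([set u; v] |: (T :\ f)))%:E).
  apply: MST_le => //; last by apply/gconnectedP => x y; apply: sub.
  by apply: subset_trans sUH; rewrite setUS // subsetDl.
rewrite lee_fin; apply: le_trans (wsum_exchange (nneg_onS sUH w0) fT) _.
by rewrite lerD2r lerB.
Qed.

Lemma spanning_tree_bottleneck H T u v W : edges_ok H -> nneg_on H ->
  spanning_tree H T -> MST w H = (wsum w T)%:E ->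
  [set u; v] \in H -> w [set u; v] < W ->
  connect (adj (lighter w T W)) u v.
Proof.
move=> okH w0 /and3P[sTH Tc _] ET uvH ltW; apply: contraT => nuv.
have := MST_le_exchange okH w0 sTH Tc uvH nuv.
by rewrite ET lee_fin -addrA lerDl addrC subr_ge0 leNgt ltW.
Qed.

(** A spanning tree of [H :\: C] joins [u] to [v] only through an edge of weight at least [W].
    Exchanging that edge for [{u,v}], which is available in [H] even if it belongs to [C], saves at
    least [W - w [set u; v]]. *)
Lemma MST_remove_cut H C u v W : edges_ok H -> nneg_on H ->
  [set u; v] \in H -> separates (lighter w H W) C u v ->
  (MST w H + (W - w [set u; v])%:E <= MST w (H :\: C))%E.
Proof.
move=> okH w0 uvH [sCL nuv].
case: (MST_cases (H :\: C)) => [->|[T /and3P[sTHC Tc _] ->]]; first exact: leey.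
have sTH : T \subset H by apply: subset_trans sTHC (subsetDl _ _).
have nuvT : ~~ connect (adj (lighter w T W)) u v.
  apply: contra nuv; apply: sub_conn; apply/subsetP => e.
  by rewrite !inE => /andP[/(subsetP sTHC)/setDP[-> ->] ->].
have := MST_le_exchange okH w0 sTH Tc uvH nuvT.
case: (MST_cases H) => [->//|[T' _ ->]].
rewrite -EFinD !lee_fin => le1; lra.
Qed.

End MinimumSpanningTrees.

(** * Kruskal merging: charging tree edges to smaller components *)

Section Kruskal.
Set Implicit Arguments.
Unset Strict Implicit.
Variables (V : finType) (R : realType) (w : {set V} -> R).
Implicit Types (S T U X : {set {set V}}) (x y : V).

Definition comp S x : {set V} := [set y | connect (adj S) x y].

Definition forest S :=
  forall x y, [set x; y] \in S -> ~~ connect (adj (S :\ [set x; y])) x y.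

Lemma forestS S X : S \subset X -> forest X -> forest S.
Proof.
move=> sSX fX x y xyS; apply: contra (fX x y (subsetP sSX _ xyS)).
by apply: sub_conn; apply: setSD.
Qed.

Lemma spanning_tree_forest X T : spanning_tree X T -> forest T.
Proof.
case/and3P=> _ /gconnectedP Tc /forall_inP mT x y xyT.
apply: contra (mT _ xyT) => xy; apply/gconnectedP => u v.
by apply: (conn_bridge xy); rewrite setD1K.
Qed.

Lemma compS S X x : S \subset X -> comp S x \subset comp X x.
Proof. by move=> sSX; apply/subsetP => y; rewrite !inE; apply: sub_conn. Qed.

Lemma comp_closed S x : closed (adj S) (comp S x).
Proof. by move=> y z yz; rewrite !inE; apply: (connect_closed (@conn_sym _ _)). Qed.

Lemma closedS S X (A : {set V}) : S \subset X -> closed (adj X) A -> closed (adj S) A.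
Proof. by move=> /subsetP sSX cl x y /sSX; apply: cl. Qed.

(** Induction on [S], undoing Kruskal's last step. [U] collects the edges of [T] not yet matched;
    keeping [U :|: S] connected is what permits the next exchange. The power of two holds because
    each time [x] is on the smaller side of a merge, its component at least doubles. *)
Lemma kruskal_charging T S : edges_ok T -> gconnected T -> edges_ok S -> forest S ->
  exists (A : {set V} -> {set V}) (g : {set V} -> {set V}) U,
  [/\ U \subset T, gconnected (U :|: S), {in S, forall e, g e \in T :\: U}
    & {in S &, injective g}] /\
  [/\ {in S, forall e, closed (adj (lighter w S (w e))) (A e)},
      {in S, forall e, crosses (A e) (g e)}
    & forall x, (2 ^ #|[set e in S | x \in A e]| <= #|comp S x|)%N].
Proof.
move=> okT Tc; move En: #|S| => n; elim: n S En => [|n IH] S En okS fS.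
  have ->: S = set0 by apply: cards0_eq.
  exists (fun=> set0), id, T; rewrite setU0; split; split=> //; do ?by move=> e; rewrite inE.
  move=> x; rewrite eq_card0 => [|e]; last by rewrite !inE.
  by rewrite expn0 card_gt0; apply/set0Pn; exists x; rewrite inE connect0.
have /card_gt0P[e0 e0S] : (0 < #|S|)%N by rewrite En.
(* With [e] heaviest, edges of [S] lighter than any given edge of [S] all lie in [S :\ e], so the
   sets [A d] of the induction stay closed. *)
have [e eS emax] := Order.TotalTheory.arg_maxP w e0S.
have {}eS : e \in S := eS.
have sS'S : S :\ e \subset S := subsetDl _ _.
have okS' := edges_okS sS'S okS.
have {En} En : #|S :\ e| = n by apply/eqP; rewrite -eqSS -En (cardsD1 e S) eS.
have {IH} [A [g [U [[sUT USc gT ginj] [Acl gcr Asz]]]]] :=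
  IH _ En okS' (forestS sS'S fS).
have eNS' : e \notin S :\ e by rewrite !inE eqxx.
have [x [y [Ee nxy lexy]]] : exists x y, [/\ e = [set x; y],
    ~~ connect (adj (S :\ e)) x y & (#|comp (S :\ e) x| <= #|comp (S :\ e) y|)%N].
  have /eqP/cards2P[x [y [_ Ee]]] := okS _ eS.
  have nxy : ~~ connect (adj (S :\ e)) x y by rewrite Ee fS // -Ee.
  have [le|/ltnW le] := leqP #|comp (S :\ e) x| #|comp (S :\ e) y|.
    by exists x, y.
  by exists y, x; rewrite conn_sym setUC.
set S' := S :\ e in sS'S okS' En USc gT ginj Acl gcr Asz eNS' nxy lexy *.
have okUS' : edges_ok (U :|: S').
  by move=> f; rewrite inE => /orP[/(subsetP sUT)/okT|/okS'].
(* The component of [x] in [S'] is closed under [S'], so the exchanged edge [f] comes from [U]; it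
   becomes the partner of [e]. *)
have [||f [fUS fS' crf sub]] := cut_exchange okUS' (subsetUr U S')
   (@comp_closed S' x) _ _ (gconnectedP _ USc x y); rewrite ?inE ?connect0 //.
have fU : f \in U by move: fUS; rewrite inE (negbTE fS') orbF.
have fT : f \in T by apply: (subsetP sUT).
pose A' := [fun z => A z with e |-> comp S' x].
pose g' := [fun z => g z with e |-> f].
have S'e d : d \in S' -> (d == e) = false by rewrite !inE => /andP[/negbTE].
have Sd d : d \in S -> d = e \/ d \in S'.
  by move=> dS; have [->|ne] := eqVneq d e; [left|right; rewrite !inE ne].
exists A', g', (U :\ f); split; split.
- exact: subset_trans (subsetDl _ _) sUT.
- apply/gconnectedP => u v; apply: sub_conn (sub _ _ (gconnectedP _ USc u v)).
  rewrite -Ee; apply/subsetP => d; rewrite !inE => /orP[/eqP->|].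
    by rewrite eS orbT.
  by case/andP=> -> /orP[->//|/andP[_ ->]]; rewrite orbT.
- move=> d /Sd[->|dS'] /=; first by rewrite eqxx !inE eqxx.
  by have := gT _ dS'; rewrite (S'e _ dS') !inE negb_and => /andP[-> ->]; rewrite orbT.
- have ginj_f d : d \in S' -> g d <> f.
    by move=> dS' E; have := gT _ dS'; rewrite E !inE fU.
  move=> d d' /Sd[->|dS'] /Sd[->|d'S'] //=; rewrite ?eqxx ?S'e //.
  + by move=> E; case: (ginj_f _ d'S').
  + by move=> E; case: (ginj_f _ dS').
  + exact: ginj.
- have light d : d \in S -> lighter w S (w d) \subset S'.
    move=> dS; apply/subsetP => h; rewrite !inE => /andP[-> ltw]; rewrite andbT.
    by apply: contraTneq ltw => ->; rewrite -leNgt; apply: emax.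
  move=> d dS; case: (Sd _ dS) => [Ed|dS'] /=.
    rewrite Ed eqxx; apply: closedS (@comp_closed S' x).
    by rewrite -Ed; apply: light.
  rewrite (S'e _ dS'); apply: closedS (Acl _ dS').
  apply/subsetP => h hL; rewrite inE (subsetP (light _ dS) _ hL).
  by move: hL; rewrite inE => /andP[].
- move=> d /Sd[->|dS'] /=; first by rewrite eqxx.
  by rewrite (S'e _ dS'); apply: gcr.
move=> z; have EA : [set d in S | z \in A' d] =
    if z \in comp S' x then e |: [set d in S' | z \in A d] else [set d in S' | z \in A d].
  apply/setP => d; have [->|ne] := eqVneq d e.
    by rewrite !inE /= eqxx eS; case: ifP => zx; rewrite !inE eqxx.
  have Hd : d \in [set d0 in S | z \in A' d0] = (d \in [set d0 in S' | z \in A d0]).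
    by rewrite !inE /= (negbTE ne).
  by case: ifP => _; rewrite Hd // !inE (negbTE ne).
rewrite {}EA; case: ifP => zx; last first.
  by apply: leq_trans (Asz z) (subset_leq_card (compS _ sS'S)).
(* The doubled power is split as a sum, one copy bounded by each of the two disjoint components that
   [e] joins, the larger one being that of [y]. *)
rewrite cardsU1 !inE eqxx /= add1n expnS mul2n -addnn.
have Ez : comp S' z = comp S' x.
  by apply/setP => t; move: zx; rewrite !inE => zx; rewrite (same_connect (@conn_sym _ _) zx).
apply: leq_trans (leq_add (Asz z) (Asz z)) _; rewrite Ez.
apply: leq_trans (leq_add (leqnn _) lexy) _.
have dis : comp S' x :&: comp S' y = set0.
  apply/setP => t; rewrite !inE; apply: contraNF nxy => /andP[xt yt].
  by apply: connect_trans xt _; rewrite conn_sym.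
rewrite -[(_ + _)%N]subn0 -(@cards0 V) -dis -cardsU; apply: subset_leq_card.
have xz : connect (adj S) x z by move: zx; rewrite inE; apply: sub_conn.
rewrite subUset -{1}Ez compS //=; apply/subsetP => t; rewrite !inE => yt.
rewrite conn_sym in xz; apply: connect_trans xz _.
apply: (@connect_trans _ _ y); first by apply: connect1; rewrite /adj -Ee.
exact: sub_conn yt.
Qed.

End Kruskal.

(** * Profitable cuts and the analysis of the two phases *)

Section Interdiction.
Set Implicit Arguments.
Unset Strict Implicit.
Variables (V : finType) (R : realType) (E : {set {set V}}) (w c : {set V} -> R).
Hypotheses (okE : edges_ok E) (Ec : gconnected E).
Hypotheses (w0 : nneg_on w E) (c0 : forall e, e \in E -> 0 < c e).
Implicit Types (F H C D T S : {set {set V}}) (u v : V).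

Let c_ge0 : nneg_on c E. Proof. by move=> e /c0/ltW. Qed.

Lemma MST_fin_num : MST w E \is a fin_num.
Proof. by have [T _ ->] := MST_attained w0 Ec. Qed.

Lemma profit_geE D (r : R) :
  (r%:E <= profit w E D)%E = (MST w E + r%:E <= MST w (E :\: D))%E.
Proof. by rewrite /profit leeBrDr ?MST_fin_num // addeC. Qed.

Lemma profitS D D' : D \subset D' -> (profit w E D <= profit w E D')%E.
Proof.
move=> sDD'; rewrite /profit leeB // MSTS ?setDS //.
by apply: nneg_onS w0; apply: subsetDl.
Qed.

Lemma profit0 : profit w E set0 = 0%E.
Proof. by rewrite /profit setD0 subee // MST_fin_num. Qed.

Lemma profit_ge0 D : (0 <= profit w E D)%E.
Proof. by rewrite -profit0 profitS // sub0set. Qed.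

Lemma profit_cut D C u v W : [set u; v] \in E :\: D ->
  separates (lighter w (E :\: D) W) C u v ->
  (profit w E D + (W - w [set u; v])%:E <= profit w E (D :|: C))%E.
Proof.
move=> uvED sep; have sED : E :\: D \subset E := subsetDl _ _.
have := MST_remove_cut (edges_okS sED okE) (nneg_onS sED w0) uvED sep.
rewrite /profit -setDDl => le; rewrite addeAC leeB //.
Qed.

Lemma log2_count (k n : nat) : (2 ^ k <= n)%N -> k%:R <= log2 n%:R :> R.
Proof.
move=> le; have n0 : (0 < n)%N by apply: leq_trans le; rewrite expn_gt0.
have ln2 : 0 < ln 2 :> R by rewrite ln_gt0 // ltr1n.
rewrite /log2 ler_pdivlMr // mulr_natl -lnXn // ler_ln ?posrE ?exprn_gt0 ?ltr0n //.
by rewrite -natrX ler_nat.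
Qed.

(** Double counting: an edge of [F] can cross [A e] only if one of its two ends lies in [A e], and
    each end lies in at most [log2 #|V|] of these sets. *)
Lemma crossing_cost F S (A : {set V} -> {set V}) : F \subset E ->
  (forall x, (2 ^ #|[set e in S | x \in A e]| <= #|V|)%N) ->
  \sum_(e in S) wsum c [set f in F | crosses (A e) f]
    <= 2 * log2 #|V|%:R * wsum c F.
Proof.
move=> sFE Asz.
have -> : \sum_(e in S) wsum c [set f in F | crosses (A e) f] =
    \sum_(f in F) c f * #|[set e in S | crosses (A e) f]|%:R.
  transitivity (\sum_(e in S) \sum_(f in F | crosses (A e) f) c f).
    by apply: eq_bigr => e _; apply: eq_bigl => f; rewrite inE.
  rewrite (exchange_big_dep (mem F)) /=; last by move=> e f _ /andP[].
  apply: eq_bigr => f fF; rewrite mulr_natr -sumr_const.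
  by apply: eq_bigl => e; rewrite inE fF.
rewrite /wsum mulr_sumr; apply: ler_sum => f fF.
have fE := subsetP sFE _ fF.
rewrite mulrC ler_pM2r ?c0 //.
have /eqP/cards2P[x [y [_ Ef]]] := okE fE.
have le : (#|[set e in S | crosses (A e) f]| <=
   #|[set e in S | x \in A e]| + #|[set e in S | y \in A e]|)%N.
  apply: leq_trans (leq_card_setU _ _); apply/subset_leq_card/subsetP => e.
  rewrite !inE => /andP[-> /andP[/existsP[a /andP[]] + aA _]].
  by rewrite Ef !inE => /orP[]/eqP <-; rewrite aA ?orbT.
have := log2_count (Asz x); have := log2_count (Asz y).
move: le; rewrite -(ler_nat R) natrD; lra.
Qed.

(** Averaging over the edges of the tree [T] of [E :\: F]: the differences [w e - w (g e)] sum to at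
    least [mF - mH] by injectivity of [g], while the crossing costs sum to at most the bound of
    [crossing_cost]. Hence some edge beats the ratio [rho]. *)
Lemma exists_profitable_cut F H (rho mF mH : R) :
  F \subset E -> H \subset E -> 0 <= rho ->
  MST w (E :\: F) = mF%:E -> MST w H = mH%:E ->
  rho * (2 * log2 #|V|%:R * wsum c F) < mF - mH ->
  exists u v W D, [/\ [set u; v] \in H, weights w E W, D \subset F,
    separates (lighter w E W) D u v & rho * wsum c D < W - w [set u; v]].
Proof.
move=> sFE sHE rho0 EF EH lt.
have sEFE : E :\: F \subset E := subsetDl _ _.
have okEF := edges_okS sEFE okE; have w0EF := nneg_onS sEFE w0.
have [T ST ET] : exists2 T, spanning_tree (E :\: F) T & MST w (E :\: F) = (wsum w T)%:E.
  by case: (MST_cases w (E :\: F)) => // Einf; rewrite Einf in EF.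
have [T0 /and3P[sT0H T0c _] ET0] :
    exists2 T0, spanning_tree H T0 & MST w H = (wsum w T0)%:E.
  by case: (MST_cases w H) => // Einf; rewrite Einf in EH.
have /and3P[sTEF _ _] := ST.
have sT0E := subset_trans sT0H sHE; have sTE := subset_trans sTEF sEFE.
have [A [g [U [[sUT0 _ gT0 ginj] [Acl gcr Asz]]]]] := kruskal_charging w
  (edges_okS sT0E okE) T0c (edges_okS sTE okE) (spanning_tree_forest ST).
have le_cost : \sum_(e in T) wsum c [set f in F | crosses (A e) f]
    <= 2 * log2 #|V|%:R * wsum c F.
  by apply: crossing_cost => // x; apply: leq_trans (Asz x) (max_card _).
have le_w : \sum_(e in T) w (g e) <= mH.
  have -> : mH = wsum w T0 by apply: EFin_inj; rewrite -EH.
  rewrite -(big_imset w ginj) /=; apply: wsumS; first exact: nneg_onS w0.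
  by apply/subsetP => _ /imsetP[e eT ->]; case/setDP: (gT0 _ eT).
have EmF : mF = \sum_(e in T) w e by apply: EFin_inj; rewrite -EF.
have [e eT gain] : exists2 e, e \in T &
    rho * wsum c [set f in F | crosses (A e) f] < w e - w (g e).
  apply/exists_inP; rewrite -[X in is_true X]negbK negb_exists_in.
  apply/negP => /forall_inP noe.
  have : \sum_(e in T) (w e - w (g e)) <=
      \sum_(e in T) rho * wsum c [set f in F | crosses (A e) f].
    by apply: ler_sum => e /noe; rewrite -leNgt.
  rewrite sumrB -mulr_sumr -EmF => le.
  have := le_trans le (ler_wpM2l rho0 le_cost); lra.
have geH : g e \in H by apply: (subsetP sT0H); case/setDP: (gT0 _ eT).
have /eqP/cards2P[u [v [_ Eg]]] := okE (subsetP sHE _ geH).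
have eE : e \in E by apply: (subsetP sTE).
(* The ends of [g e] lie on different sides of [A e]. Only crossing edges lighter than [w e] are
   kept, so that the set is a cut of the lighter graph. *)
exists u, v, (w e), [set f in F | crosses (A e) f && (f \in lighter w E (w e))].
split.
- by rewrite -Eg.
- by apply/exists_inP; exists e.
- by apply/subsetP => f; rewrite inE => /andP[].
- split; first by apply/subsetP => f; rewrite inE => /and3P[].
  (* A remaining light edge in [F] does not cross [A e]. One outside [F] has its ends joined in [T]
     by edges lighter than [w e], under which [A e] is closed. *)
  set L := _ :\: _; have clL : closed (adj L) (A e).
    move=> x y; rewrite /adj !inE => /andP[nD /andP[xyE ltw]].
    rewrite xyE ltw !andbT in nD.
    have [xyF|nxyF] := boolP ([set x; y] \in F).
      rewrite xyF /= negb_and !negb_exists_in in nD.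
      case/orP: nD => /forall_inP nD; have := nD x; have := nD y;
        rewrite set21 set22 => /(_ isT) + /(_ isT).
        by move=> /negbTE-> /negbTE->.
      by rewrite !negbK => -> ->.
    apply: (closed_connect (Acl _ eT)).
    apply: (spanning_tree_bottleneck okEF w0EF ST ET) => //.
    by rewrite inE nxyF.
  apply: contraL (gcr _ eT) => uv.
  have Auv := closed_connect clL uv.
  rewrite Eg; apply/negP => /andP[/existsP[a /andP[+ aA]] /existsP[b /andP[+ /negP bA]]].
  rewrite !inE => /orP[]/eqP Ea /orP[]/eqP Eb; subst a b; apply: bA; rewrite // ?Auv //.
  by rewrite -Auv.
rewrite -Eg; apply: le_lt_trans gain; apply: ler_wpM2l => //.
apply: wsumS; last by apply/subsetP => f; rewrite !inE => /and3P[-> ->].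
by apply: nneg_onS c_ge0; apply/subsetP => f; rewrite inE => /andP[/(subsetP sFE)].
Qed.

Lemma separates_lighterS H D u v W : H \subset E ->
  separates (lighter w E W) D u v ->
  separates (lighter w H W) (D :&: lighter w H W) u v.
Proof.
move=> sHE [_ nuv]; split; first exact: subsetIr.
apply: contra nuv; apply: sub_conn; apply/subsetP => f; rewrite !inE.
by move=> /andP[+ /andP[fH ltw]]; rewrite fH ltw (subsetP sHE _ fH) !andbT.
Qed.

(** The trace of [D] in the lighter part of [H] still separates [u] from [v], so the cheapest cut
    [C] costs no more and inherits the ratio. Its cost is positive since the light edge [{u,v}]
    forces [C] to be nonempty. *)
Lemma min_sep_ratio F H D C u v W (rho : R) : 0 <= rho -> F \subset E ->
  H \subset E -> [set u; v] \in H -> D \subset F ->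
  separates (lighter w E W) D u v -> rho * wsum c D < W - w [set u; v] ->
  min_sep c (lighter w H W) C u v ->
  [/\ 0 < wsum c C, 0 < W - w [set u; v] & rho * wsum c C <= W - w [set u; v]].
Proof.
move=> rho0 sFE sHE uvH sDF sep lt [[sC nuv] minC].
have sDE := subset_trans sDF sFE.
have cD0 : 0 <= wsum c D by apply: wsum_ge0; apply: nneg_onS c_ge0.
have gain0 : 0 < W - w [set u; v] by apply: le_lt_trans lt; apply: mulr_ge0.
have leD : wsum c C <= wsum c D.
  apply: le_trans (minC _ (separates_lighterS sHE sep)) _.
  by apply: wsumS (subsetIl _ _); apply: nneg_onS c_ge0.
split=> //; last by apply: le_trans (ltW lt); apply: ler_wpM2l.
have [f fC] : exists f, f \in C.
  apply/set0Pn; apply: contraNneq nuv => ->; rewrite setD0; apply: connect1.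
  by rewrite /adj inE uvH -subr_gt0.
have sCE := subset_trans sC (subset_trans (lighter_sub w _ _) sHE).
rewrite /wsum (bigD1 f) //= ltr_wpDr ?c0 ?(subsetP sCE) //.
by apply: sumr_ge0 => h /andP[/(subsetP sCE)/c_ge0].
Qed.

Lemma phase1_cost B C0 : 0 < B -> phase1 w c E B C0 -> wsum c C0 <= B.
Proof.
move=> B0 [cut [_ [[u [v [W [[_ _ le] -> _ _]]]]|[-> _]]]] //.
by rewrite wsum0 ltW.
Qed.

(** The minimum cut for [u], [v], [W] is no dearer than [D], hence a candidate of phase 1, and gains
    at least [W - w [set u; v]]. If [C0] is empty by default, all candidates have profit at most
    [0], the profit of [C0]. *)
Lemma phase1_profit B C0 D u v W : phase1 w c E B C0 ->
  [set u; v] \in E -> weights w E W -> separates (lighter w E W) D u v ->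
  wsum c D <= B -> ((W - w [set u; v])%:E <= profit w E C0)%E.
Proof.
move=> [cut [vcut ph]] uvE wW sep leB.
have [sepC minC] := vcut _ _ _ uvE wW.
have leC : wsum c (cut u v W) <= B by apply: le_trans (minC _ sep) leB.
have gain : ((W - w [set u; v])%:E <= profit w E (cut u v W))%E.
  by have := @profit_cut set0 (cut u v W) u v W; rewrite setD0 set0U profit0 add0e; apply.
apply: le_trans gain _.
case: ph => [[u' [v' [W' [_ _ _ maxC]]]]|[-> maxC]]; first exact: maxC.
by rewrite profit0; apply: maxC.
Qed.

Lemma phase2_cost B E' b Fg Fout : phase2 w c E B E' b Fg Fout ->
  E' = E :\: Fg -> b = wsum c Fg -> b <= B ->
  Fg \subset Fout /\ wsum c Fout <= B.
Proof.
elim=> {E' b Fg Fout} [E' b Fg cut _ _ _ <- //|].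
move=> E' b Fg cut u v W Fout vcut uvE' wW /andP[_ leB] _ _ _ IH EE' Eb _.
have [[sC _] _] := vcut _ _ _ uvE' wW.
have sCE' := subset_trans sC (lighter_sub w _ _).
have [||//|sF leF] := IH; first by rewrite EE' setDDl.
  rewrite Eb wsumU // disjoint_sym disjoints_subset; apply: subset_trans sCE' _.
  by rewrite EE'; apply/subsetP => f; rewrite !inE => /andP[].
by split=> //; apply: subset_trans sF; apply: subsetUl.
Qed.

(* The second alternative arises in a state where a cut of ratio at least [rho]
   no longer fits in the budget. *)
Lemma phase2_profit B E' b Fg Fout F (rho t : R) :
  phase2 w c E B E' b Fg Fout ->
  (forall H, H \subset E -> (MST w H < MST w E + t%:E)%E ->
     exists u v W D, [/\ [set u; v] \in H, weights w E W, D \subset F,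
       separates (lighter w E W) D u v & rho * wsum c D < W - w [set u; v]]) ->
  F \subset E -> 0 <= rho -> E' = E :\: Fg -> b = wsum c Fg -> b <= B ->
  ((rho * b)%:E <= profit w E Fg)%E ->
  (t%:E <= profit w E Fout)%E \/
  exists u v W D, [/\ [set u; v] \in E, weights w E W, D \subset F,
    separates (lighter w E W) D u v &
    ((rho * B)%:E <= profit w E Fout + (W - w [set u; v])%:E)%E].
Proof.
move=> ph good sFE rho0.
(* When [D'] exceeds the budget, [rho * B] is at most [rho * b1], covered by the profit so far, plus
   [rho * wsum c D'], covered by the gain. *)
have overflow b1 (Fg' Fout' : {set {set V}}) u v W D D' : B < b1 + wsum c D' ->
    [set u; v] \in E -> weights w E W -> D \subset F ->
    separates (lighter w E W) D u v ->
    rho * wsum c D' <= W - w [set u; v] ->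
    ((rho * b1)%:E <= profit w E Fg')%E -> Fg' \subset Fout' ->
    exists u v W D, [/\ [set u; v] \in E, weights w E W, D \subset F,
      separates (lighter w E W) D u v &
      ((rho * B)%:E <= profit w E Fout' + (W - w [set u; v])%:E)%E].
  move=> over uvE wW sDF sep le pr sub; exists u, v, W, D; split=> //.
  apply: (@le_trans _ _ ((rho * b1)%:E + (W - w [set u; v])%:E)%E).
    rewrite -EFinD lee_fin; apply: le_trans (lerD (lexx _) le).
    by rewrite -mulrDr; apply: ler_wpM2l => //; apply: ltW.
  by apply: leeD => //; apply: le_trans pr (profitS sub).
(* Profits grow along the loop, so a final profit below [t] makes [good] applicable in every earlier
   state. *)
have small (Fg' Fout' : {set {set V}}) : Fg' \subset Fout' ->
    ~~ (t%:E <= profit w E Fout')%E ->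
    (MST w (E :\: Fg') < MST w E + t%:E)%E.
  move=> sub; apply: contraR; rewrite -leNgt -profit_geE => /le_trans; apply.
  exact: profitS.
elim: ph => [{}E' {}b {}Fg cut vcut stop|{}E' {}b {}Fg cut u v W {}Fout vcut uvE' wW
  /andP[ltb leB] ratio maxr ph IH] EE' Eb leb pr.
- have [|nt] := boolP (t%:E <= profit w E Fg)%E; first by left.
  right; have sE'E : E' \subset E by rewrite EE' subsetDl.
  have [|u [v [W [D [uvE' wW sDF sep lt]]]]] := good E' sE'E.
    by rewrite EE' (small _ Fg).
  have [cp gp le] := min_sep_ratio rho0 sFE sE'E uvE' sDF sep lt (vcut _ _ _ uvE' wW).
  have [fits|over] := leP (b + wsum c (cut u v W)) B; last first.
    by apply: overflow over (subsetP sE'E _ uvE') wW sDF sep le pr (subxx _).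
  have := stop u v W uvE' wW; rewrite ltrDl cp fits => /(_ isT).
  by rewrite leNgt divr_gt0.
- have [|nt] := boolP (t%:E <= profit w E Fout)%E; first by left.
  have sE'E : E' \subset E by rewrite EE' subsetDl.
  have sepC := vcut _ _ _ uvE' wW.
  have sCE' : cut u v W \subset E'.
    by have [[sC _] _] := sepC; apply: subset_trans sC (lighter_sub w _ _).
  have EE'' : E' :\: cut u v W = E :\: (Fg :|: cut u v W) by rewrite EE' setDDl.
  have Eb' : b + wsum c (cut u v W) = wsum c (Fg :|: cut u v W).
    rewrite Eb wsumU // disjoint_sym disjoints_subset; apply: subset_trans sCE' _.
    by rewrite EE'; apply/subsetP => f; rewrite !inE => /andP[].
  have [sub _] := phase2_cost ph EE'' Eb' leB.
  have sFg := subset_trans (subsetUl _ _) sub.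
  have [|u' [v' [W' [D [uvE'' wW' sDF sep lt]]]]] := good E' sE'E.
    by rewrite EE' (small _ Fout).
  have [cp gp le] :=
    min_sep_ratio rho0 sFE sE'E uvE'' sDF sep lt (vcut _ _ _ uvE'' wW').
  have [fits|over] := leP (b + wsum c (cut u' v' W')) B; last first.
    right.
    by apply: overflow over (subsetP sE'E _ uvE'') wW' sDF sep le pr sFg.
  rewrite (negbTE nt) in IH; apply: IH => //.
  have cp0 : 0 < wsum c (cut u v W) by move: ltb; rewrite ltrDl.
  (* The greedy choice is at least as good as the fitting cut found through [good]; this preserves
     the invariant that the profit is at least [rho] times the cost spent. *)
  have leC : rho * wsum c (cut u v W) <= W - w [set u; v].
    rewrite -ler_pdivlMr //; apply: le_trans (maxr u' v' W' uvE'' wW' _).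
      by rewrite ler_pdivlMr.
    by rewrite ltrDl cp fits.
  rewrite EE' in uvE' sepC; apply: le_trans (profit_cut uvE' sepC.1).
  rewrite mulrDr EFinD; apply: leeD => //.
Qed.

End Interdiction.

(** * The threshold and the approximation guarantee *)

Lemma one_le_log2 (R : realType) (n : nat) : (1 < n)%N -> 1 <= log2 n%:R :> R.
Proof. exact: (@log2_count R 1). Qed.

(** With [x = 1 / L], the product [t * (4 * L + 1)] equals [Delta / 4 * (4 - 3 * x - x ^+ 2)]. The
    subtracted [1 / L ^+ 2] pays for the summand [1], which accounts for a profit of up to [t]
    already obtained. *)
Lemma threshold_bound (R : realType) (L Delta : R) : 1 <= L -> 0 <= Delta ->
  let t := Delta / 4 * (1 / L - 1 / L ^+ 2) in 0 <= t /\ t * (4 * L + 1) <= Delta.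
Proof.
move=> L1 D0 /=; have L0 : 0 < L by lra.
have xL : L^-1 * L = 1 by rewrite mulVf // gt_eqF.
have x0 : 0 < L^-1 by rewrite invr_gt0.
have x1 : L^-1 <= 1 by rewrite invf_le1.
rewrite !div1r -exprVn; move: xL x0 x1; set x := L^-1 => xL x0 x1.
have xx : 0 <= x - x ^+ 2 by nra.
split; first by rewrite mulr_ge0 // divr_ge0.
have -> : Delta / 4 * (x - x ^+ 2) * (4 * L + 1) =
    Delta / 4 * ((x * L) * 4 * (1 - x) + x - x ^+ 2) by field.
rewrite xL; nra.
Qed.

Theorem mainTheorem17 (V : finType) (R : realType) (E : {set {set V}})
  (w c : {set V} -> R) (B Delta : R) (F C0 Fg : {set {set V}}) :
  (3 <= #|V|)%N ->
  edges_ok E ->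
  gconnected E ->
  (forall e, e \in E -> 0 <= w e) ->
  (forall e, e \in E -> 0 < c e) ->
  0 < B ->
  F \subset E -> wsum c F <= B -> profit w E F = Delta%:E ->
  phase1 w c E B C0 ->
  phase2 w c E B E 0 set0 Fg ->
  let n : R := #|V|%:R in
  wsum c (output w E C0 Fg) <= B /\
  ((Delta / 4 * (1 / log2 n - 1 / (log2 n) ^+ 2))%:E
     <= profit w E (output w E C0 Fg))%E.
Proof.
move=> n3 okE Ec w0 c0 B0 sFE leF prF ph1 ph2 n; set L := log2 n.
have L1 : 1 <= L by apply: one_le_log2; apply: ltnW.
have Delta0 : 0 <= Delta by rewrite -lee_fin -prF profit_ge0.
have [] := threshold_bound L1 Delta0; set t := (_ * _) => t0 tD.
have leC0 := phase1_cost B0 ph1.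
have [|||_ leFg] := phase2_cost ph2; [by rewrite setD0|by rewrite wsum0|exact: ltW|].
have costs : wsum c (output w E C0 Fg) <= B by rewrite /output; case: ifP.
split; first exact: costs.
suff : (t%:E <= profit w E C0)%E \/ (t%:E <= profit w E Fg)%E.
  rewrite /output; case: ifPn => [le|].
    by case=> // h; apply: le_trans h le.
  by rewrite -ltNge => /ltW le [h|//]; apply: le_trans h le.
have [T _ Em] := MST_attained w0 Ec.
set m := wsum w T in Em.
have EmF : MST w (E :\: F) = (m + Delta)%:E.
  by move: prF; rewrite /profit Em; case: MST => // r [<-]; rewrite [m + _]addrC subrK.
(* Chosen so that [rho * B = 2 * t]: if a good cut overflows the budget, the profits of the two
   phases sum to at least [2 * t], and one of them reaches [t]. *)
pose rho := 2 * t / B.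
have rho0 : 0 <= rho by rewrite /rho; apply: divr_ge0; [apply: mulr_ge0|apply: ltW].
have good (H : {set {set V}}) : H \subset E -> (MST w H < MST w E + t%:E)%E ->
    exists u v W (D : {set {set V}}), [/\ [set u; v] \in H, weights w E W, D \subset F,
      separates (lighter w E W) D u v & rho * wsum c D < W - w [set u; v]].
  move=> sHE; rewrite Em -EFinD.
  case EH : (MST w H) => [mH| |] //; last first.
    by case: (MST_cases w H) => [|[? _]]; rewrite EH.
  rewrite lte_fin => lt.
  apply: (exists_profitable_cut okE w0 c0 sFE sHE rho0 EmF EH).
  (* Since [mH < m + t], the remaining gap [m + Delta - mH] exceeds [Delta - t], which is at least
     [4 * L * t] by [tD]. *)
  have : rho * (2 * L * wsum c F) <= 4 * L * t.
    have -> : 4 * L * t = rho * (2 * L * B) by rewrite /rho; field; rewrite gt_eqF.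
    by rewrite ler_wpM2l // ler_wpM2l //; lra.
  rewrite -/n -/L; lra.
have [||||tFg|] := phase2_profit okE Ec w0 c0 ph2 good sFE rho0;
  [by rewrite setD0|by rewrite wsum0|exact: ltW|by rewrite mulr0 profit_ge0|by right|].
move=> [u [v [W [D [uvE wW sDF sep le]]]]].
have leD : wsum c D <= B.
  by apply: le_trans leF; apply: wsumS => // f /(subsetP sFE)/c0/ltW.
have leP := phase1_profit okE Ec w0 ph1 uvE wW sep leD.
have {le leP} : ((2 * t)%:E <= profit w E Fg + profit w E C0)%E.
  have -> : 2 * t = rho * B by rewrite /rho divfK // gt_eqF.
  by apply: le_trans le _; apply: leeD.
case: (leP t%:E (profit w E C0)) => [|ltC]; first by left.
case: (leP t%:E (profit w E Fg)) => [|ltF]; first by right.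
have := lteD ltF ltC; rewrite -EFinD => lt /le_lt_trans/(_ lt).
by rewrite lte_fin; lra.
Qed.
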